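(* The IPEN states constructed from entangled $\rho_e$ (that is, $\rho=\bigotimes_{e\in E}\rho_e$ with $\rho_e=p\,\Phi_e+(1-p)\,\mathbb{I}_e/d^2$ and $p>1/(d+1)$) exhibit genuine multipartite entanglement (GME) as $|V|\to\infty$, provided that each party is asymptotically connected to more than half of the remaining parties, i.e., $$\lim_{|V|\to\infty}\frac{\deg(v)}{|V|}>\frac12\quad\text{for every } v\in V.$$
   Context: A quantum network is described by a connected undirected graph $G=(V,E)$ whose vertices are the parties and whose edges are unordered pairs of distinct vertices; the statement concerns a sequence of such networks of growing size $|V|$. To each edge $e=(u,v)$ is attached a copy of $\mathbb{C}^d\otimes\mathbb{C}^d$ ($d\ge2$), one tensor factor held by $u$ and the other by $v$, carrying a bipartite state $\rho_e$; each party holds all tensor factors located at its vertex, and the network state is $\rho=\bigotimes_{e\in E}\rho_e$. $\deg(v)$ is the number of edges incident with $v$, equivalently the number of vertices adjacent to $v$. $\mathbb{I}_e$ is the identity on the space of edge $e$, and $\Phi_e=|\phi^+\rangle\langle\phi^+|$ with $|\phi^+\rangle=\frac{1}{\sqrt d}\sum_{i=0}^{d-1}|ii\rangle$. An isotropic pair-entangled network (IPEN) state is a network state in which every edge carries $\rho_e=p\,\Phi_e+(1-p)\,\mathbb{I}_e/d^2$ with the same visibility $p$ for all edges; $\rho_e$ is entangled exactly when $p>1/(d+1)$. A state of the parties is biseparable if it can be written as a mixture of states each of which is separable with respect to some bipartition $S|V\setminus S$ of the parties ($\emptyset\ne S\subsetneq V$); otherwise it exhibits GME. *)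

(* Defs.v *)
From HB Require Import structures.
From mathcomp Require Import all_boot all_order all_algebra.
From mathcomp Require Import spectral complex.
From mathcomp Require Import all_classical all_reals all_analysis.

Set Implicit Arguments.
Unset Strict Implicit.
Unset Printing Implicit Defensive.

Import Order.TTheory GRing.Theory Num.Theory.
Import numFieldNormedType.Exports.

Local Open Scope ring_scope.
Local Open Scope complex_scope.
Local Open Scope sesquilinear_scope.

(* Operators on C^T, as matrices whose rows and columns are indexed through
   the canonical enumeration of [T]. *)
Definition op (R : realType) (T : finType) := 'M[R[i]]_#|T|.

Definition mkop (R : realType) (T : finType) (f : T -> T -> R[i]) : op R T :=
  \matrix_(i, j) f (enum_val i) (enum_val j).

Definition entry (R : realType) (T : finType) (A : op R T) (s t : T) : R[i] :=
  A (enum_rank s) (enum_rank t).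

(* In the order of [R[i]], [0 <= z] means that z is real and nonnegative, so
   the second condition also forces [A] to be Hermitian. *)
Definition density (R : realType) (T : finType) (A : op R T) : Prop :=
  \tr A = 1 /\ forall v : 'cV[R[i]]_#|T|, 0 <= (v ^t* *m A *m v) 0 0.

Definition mixture (R : realType) (T : finType) (P : op R T -> Prop)
    (A : op R T) : Prop :=
  exists (m : nat) (w : 'I_m -> R) (B : 'I_m -> op R T),
    [/\ forall i, 0 <= w i, \sum_i w i = 1, forall i, P (B i)
      & A = \sum_i (w i)%:C *: B i].

(* A system of qudits indexed by [H]; the qudit [h] is located at the party
   [own h].  The basis vectors of the joint space are the assignments
   [{ffun H -> 'I_d}], and those of the space jointly held by a set [S] of
   parties are the assignments to the qudits located in [S]. *)
Section Multipartite.
Variables (R : realType) (d : nat) (V H : finType) (own : H -> V).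

Definition held (S : {set V}) : finType := {h : H | own h \in S}.

Definition restrict (S : {set V}) (x : {ffun H -> 'I_d}) :
    {ffun held S -> 'I_d} :=
  [ffun h => x (val h)].

Definition tensor_cut (S : {set V})
    (A : op R {ffun held S -> 'I_d}) (B : op R {ffun held (~: S) -> 'I_d}) :
    op R {ffun H -> 'I_d} :=
  mkop (fun x y => entry A (restrict S x) (restrict S y)
                 * entry B (restrict (~: S) x) (restrict (~: S) y)).

Definition product_across (S : {set V}) (rho : op R {ffun H -> 'I_d}) : Prop :=
  exists (A : op R {ffun held S -> 'I_d})
         (B : op R {ffun held (~: S) -> 'I_d}),
    [/\ density A, density B & rho = tensor_cut A B].

Definition separable_across (S : {set V}) : op R {ffun H -> 'I_d} -> Prop :=
  mixture (product_across S).

Definition biseparable : op R {ffun H -> 'I_d} -> Prop :=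
  mixture (fun sigma =>
    exists S : {set V},
      [/\ S != finset.set0, S != [set: V]%SET & separable_across S sigma]).

Definition GME (rho : op R {ffun H -> 'I_d}) : Prop :=
  density rho /\ ~ biseparable rho.

End Multipartite.

Record network := Network {
  party :> finType;
  adj : rel party;
  adj_sym : symmetric adj;
  adj_irr : irreflexive adj;
  party_nonempty : (0 < #|party|)%N;
  adj_connected : forall u v, connect adj u v
}.

Definition deg (G : network) (v : G) : nat := #|[set u | adj v u]%SET|.

(* The dart (u, v) is the tensor factor of the edge {u, v} held by u; the
   other factor of the same edge is the reversed dart (v, u). *)
Definition dart (G : network) : finType := {a : G * G | adj a.1 a.2}.

Definition holder (G : network) (a : dart G) : G := (val a).1.

Lemma rev_dart_subproof (G : network) (a : dart G) :
  adj (val a).2 (val a).1.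
Proof. by rewrite adj_sym; exact: (valP a). Qed.

Definition rev_dart (G : network) (a : dart G) : dart G :=
  exist (fun b : G * G => adj b.1 b.2) ((val a).2, (val a).1)
    (rev_dart_subproof a).

(* Each edge {u, v} has exactly one positively oriented dart; it fixes which
   of the two tensor factors of the edge comes first. *)
Definition positive (G : network) (a : dart G) : bool :=
  (enum_rank (val a).1 < enum_rank (val a).2)%N.

Definition on_edge (G : network) (d : nat) (a : dart G)
    (x : {ffun dart G -> 'I_d}) : 'I_d * 'I_d :=
  (x a, x (rev_dart a)).

(* The tensor product of the [rho a] over all edges, each edge being
   represented by its positively oriented dart [a]. *)
Definition network_state (R : realType) (G : network) (d : nat)
    (rho : dart G -> op R ('I_d * 'I_d)%type) : op R {ffun dart G -> 'I_d} :=
  mkop (fun x y =>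
    \prod_(a : dart G | positive a) entry (rho a) (on_edge a x) (on_edge a y)).

Definition phi_plus (R : realType) (d : nat) : 'cV[R[i]]_#|{: 'I_d * 'I_d}| :=
  \col_k (if (enum_val k).1 == (enum_val k).2
          then ((Num.sqrt (d%:R : R))^-1)%:C else 0).

Definition Phi_plus (R : realType) (d : nat) : op R ('I_d * 'I_d)%type :=
  phi_plus R d *m (phi_plus R d) ^t*.

Definition isotropic (R : realType) (d : nat) (p : R) :
    op R ('I_d * 'I_d)%type :=
  p%:C *: Phi_plus R d + ((1 - p) / d%:R ^+ 2)%:C *: 1%:M.

Definition IPEN (R : realType) (d : nat) (p : R) (G : network) :
    op R {ffun dart G -> 'I_d} :=
  network_state (fun _ : dart G => isotropic d p).

(* Main.v *)
Require Import Defs.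
From mathcomp Require Import all_boot all_order all_algebra.
From mathcomp Require Import spectral complex ring lra zify.
From mathcomp Require Import all_classical all_reals all_analysis.

Set Implicit Arguments.
Unset Strict Implicit.
Unset Printing Implicit Defensive.

Import Order.TTheory GRing.Theory Num.Theory.
Import numFieldNormedType.Exports.

(** For a proper cut [S] of the parties let [k_S] be the number of edges
crossing it and let [Pi_S] be the tensor product of the projectors [1 - Phi]
over these edges.  The witness is the sum over all proper cuts of
[(1 - 1/d)^(-k_S) Pi_S].  Under partial transposition [1 - Phi] becomes
[1 - F/d >= 1 - 1/d], where [F] is the flip, so every state separable across
[S] satisfies [Tr (Pi_S sigma) >= (1 - 1/d)^(k_S)], and the witness is at least
[1] on biseparable states.  On the IPEN state it equals the sum over the proper
cuts of [r^(k_S)] with [r = (1 - p) (1 + 1/d)], and [r < 1] iff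
[p > 1/(d + 1)].  If all degrees are at least [(1/2 + e) N], where [N = |V|],
then [k_S >= e N min (|S|, N - |S|)], hence this sum is at most
[2 ((1 + r^(e N))^N - 1)], which tends to [0]. *)

Local Open Scope ring_scope.

(** * Positive semidefinite kernels *)

Section Gram.
Variable C : numClosedFieldType.
Implicit Types T : finType.

(* Positive semidefiniteness in factored form, which makes the stability under
   pointwise products, hence under tensor products, immediate. *)
Definition gram T (K : T -> T -> C) :=
  exists (I : finType) (c : I -> T -> C),
    forall s t, K s t = \sum_i c i s * (c i t)^*.

Lemma gram_ge0 T (K : T -> T -> C) (v : T -> C) :
  gram K -> 0 <= \sum_s \sum_t (v s)^* * K s t * v t.
Proof.
move=> [I [c Kc]].
have -> : \sum_s \sum_t (v s)^* * K s t * v t =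
    \sum_i (\sum_s (v s)^* * c i s) * (\sum_s (v s)^* * c i s)^*.
  under eq_bigr do under eq_bigr do rewrite Kc mulr_sumr mulr_suml.
  under eq_bigr do rewrite exchange_big.
  rewrite exchange_big; apply: eq_bigr => i _.
  rewrite rmorph_sum big_distrlr; apply: eq_bigr => s _.
  by apply: eq_bigr => t _; rewrite rmorphM /= conjCK -!mulrA [_^* * v t]mulrC.
by apply: sumr_ge0 => i _; exact: mul_conjC_ge0.
Qed.

Lemma gram_sum_ge0 T (K : T -> T -> C) : gram K -> 0 <= \sum_s \sum_t K s t.
Proof.
move=> /(gram_ge0 (fun=> 1)); congr (_ <= _).
by apply: eq_bigr => s _; apply: eq_bigr => t _; rewrite rmorph1 mul1r mulr1.
Qed.

Lemma gram_diag_ge0 T (K : T -> T -> C) s : gram K -> 0 <= K s s.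
Proof.
by move=> [I [c ->]]; apply: sumr_ge0 => i _; exact: mul_conjC_ge0.
Qed.

Lemma eq_gram T (K L : T -> T -> C) : K =2 L -> gram K -> gram L.
Proof. by move=> KL [I [c Kc]]; exists I, c => s t; rewrite -KL. Qed.

Lemma gram1 T : gram (fun _ _ : T => 1 : C).
Proof.
by exists unit, (fun _ _ => 1) => s t; rewrite big_const card_unit /= rmorph1 mulr1 addr0.
Qed.

(** Schur product theorem: in factored form the factors simply multiply, indexed by pairs. *)
Lemma gramM T (K L : T -> T -> C) :
  gram K -> gram L -> gram (fun s t => K s t * L s t).
Proof.
move=> [I [c Kc]] [J [e Le]].
exists (I * J)%type, (fun k s => c k.1 s * e k.2 s) => s t.
rewrite Kc Le big_distrlr pair_big; apply: eq_bigr => k _.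
by rewrite rmorphM /= mulrACA.
Qed.

Lemma gram_prod T (I : finType) (P : pred I) (K : I -> T -> T -> C) :
  (forall i, P i -> gram (K i)) -> gram (fun s t => \prod_(i | P i) K i s t).
Proof.
move=> gK.
have gr (r : seq I) : gram (fun s t => \prod_(i <- r | P i) K i s t).
  elim: r => [|i r IH].
    by apply: eq_gram (gram1 T) => s t; rewrite big_nil.
  have [Pi|Pi] := boolP (P i); last first.
    by apply: eq_gram IH => s t; rewrite big_cons (negPf Pi).
  by apply: eq_gram (gramM (gK i Pi) IH) => s t; rewrite big_cons Pi.
exact: gr.
Qed.

Lemma gram_comp T T' (f : T' -> T) (K : T -> T -> C) :
  gram K -> gram (fun s t => K (f s) (f t)).
Proof. by move=> [I [c Kc]]; exists I, (fun i s => c i (f s)) => s t. Qed.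

Lemma gramD T (K L : T -> T -> C) :
  gram K -> gram L -> gram (fun s t => K s t + L s t).
Proof.
move=> [I [c Kc]] [J [e Le]].
exists (I + J)%type, (fun k s => match k with inl i => c i s | inr j => e j s end).
by move=> s t; rewrite big_sumType Kc Le.
Qed.

Lemma gramZ T (a : C) (K : T -> T -> C) :
  0 <= a -> gram K -> gram (fun s t => a * K s t).
Proof.
move=> a0 [I [c Kc]]; exists I, (fun i s => sqrtC a * c i s) => s t.
rewrite Kc mulr_sumr; apply: eq_bigr => i _.
have sa : (sqrtC a)^* = sqrtC a by apply: geC0_conj; rewrite sqrtC_ge0.
by rewrite rmorphM /= sa mulrACA -expr2 sqrtCK.
Qed.

Lemma gram_sum T (I : finType) (K : I -> T -> T -> C) :
  (forall i, gram (K i)) -> gram (fun s t => \sum_i K i s t).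
Proof.
move=> gK.
have gr (r : seq I) : gram (fun s t => \sum_(i <- r) K i s t).
  elim: r => [|i r IH].
    by exists 'I_0, (fun _ _ => 0) => s t; rewrite big_nil big_ord0.
  by apply: eq_gram (gramD (gK i) IH) => s t; rewrite big_cons.
exact: gr.
Qed.

Lemma gram_tr T (K : T -> T -> C) : gram K -> gram (fun s t => K t s).
Proof.
move=> [I [c Kc]]; exists I, (fun i s => (c i s)^*) => s t.
by rewrite Kc; apply: eq_bigr => i _; rewrite conjCK mulrC.
Qed.

Lemma gram_delta T : gram (fun s t : T => (s == t)%:R : C).
Proof.
exists T, (fun i s => (s == i)%:R) => s t.
rewrite (bigD1 s)//= eqxx mul1r big1 ?addr0.
  by rewrite rmorph_nat eq_sym.
by move=> i /negPf; rewrite eq_sym => ->; rewrite mul0r.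
Qed.

(** Each factor is replaced by its difference with its pullback along [tau]. For [tau] a flip this
    is antisymmetrisation, which drives the induction in [flip_form_ge]. *)
Lemma gram_anti T (tau : T -> T) (K : T -> T -> C) : gram K ->
  gram (fun s t => K s t - K s (tau t) - K (tau s) t + K (tau s) (tau t)).
Proof.
move=> [I [c Kc]]; exists I, (fun i s => c i s - c i (tau s)) => s t.
rewrite !Kc -!sumrB -big_split; apply: eq_bigr => i _ /=.
by rewrite rmorphB /=; ring.
Qed.

(** * Spectral theorem: nonnegative quadratic forms give factored kernels *)

Lemma spectral_diag_form n (A : 'M[C]_n) (i : 'I_n) : A \is normalmx ->
  exists v : 'cV[C]_n, spectral_diag A 0 i = (v ^t* *m A *m v)%sesqui 0 0.
Proof.
move=> /orthomx_spectralP Aeq; set P := spectralmx A in Aeq.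
have Pu : P \is unitarymx := spectral_unitarymx A.
(* The rows of the unitary [P] are the adjoints of eigenvectors of [A]. *)
exists ((row i P) ^t*)%sesqui; rewrite trmxCK.
have <- : (P *m A *m (P ^t*)%sesqui) i i = spectral_diag A 0 i.
  rewrite {1}Aeq invmx_unitary// !mulmxA (unitarymxP Pu) mul1mx.
  by rewrite -mulmxA (unitarymxP Pu) mulmx1 mxE eqxx mulr1n.
by rewrite -row_mul !mxE; apply: eq_bigr => j _; rewrite !mxE.
Qed.

Lemma form_eq0 n (B : 'M[C]_n) : B \is normalmx ->
  (forall v : 'cV[C]_n, (v ^t* *m B *m v)%sesqui 0 0 = 0) -> B = 0.
Proof.
move=> Bn B0; have /orthomx_spectralP -> := Bn.
have -> : spectral_diag B = 0; last by rewrite linear0 mulmx0 mul0mx.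
apply/rowP => i; have [v ->] := spectral_diag_form i Bn.
by rewrite B0 mxE.
Qed.

(** The form of [A] is real, so the form of [A] minus its adjoint vanishes. That difference is
    skew-Hermitian, hence normal, hence zero by [form_eq0]; so [A] is Hermitian. *)
Lemma psd_normal n (A : 'M[C]_n) :
  (forall v : 'cV[C]_n, 0 <= (v ^t* *m A *m v)%sesqui 0 0) -> A \is normalmx.
Proof.
move=> A0; apply: hermitian_normalmx; apply/is_hermitianmxP.
rewrite expr0 scale1r; apply/eqP; rewrite -subr_eq0; apply/eqP.
set B := A - _.
have BN : (B ^t*)%sesqui = - B.
  by rewrite /B linearB /= map_mxB /= trmxCK opprB.
apply: form_eq0 => [|v].
  by apply/normalmxP; rewrite BN mulmxN mulNmx.
have vA : ((v ^t* *m (A ^t*) *m v) 0 0 = ((v ^t* *m A *m v) 0 0)^*)%sesqui.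
  rewrite -[in LHS](trmxCK v) -!map_mxM -!trmx_mul trmxCK.
  by rewrite [LHS]mxE [in LHS]mxE mulmxA.
rewrite /B mulmxBr mulmxBl mxE [X in _ + X]mxE vA.
by rewrite geC0_conj ?A0// subrr.
Qed.

(** The factors are the eigenvectors scaled by the square roots of their eigenvalues, which are
    values of the form and so nonnegative. *)
Lemma psd_gram n (A : 'M[C]_n) :
  (forall v : 'cV[C]_n, 0 <= (v ^t* *m A *m v)%sesqui 0 0) ->
  gram (fun i j => A i j).
Proof.
move=> A0; have An := psd_normal A0.
set P := spectralmx A; set D := spectral_diag A.
have D0 i : 0 <= D 0 i by have [v ->] := spectral_diag_form i An.
exists 'I_n, (fun i s => sqrtC (D 0 i) * (P i s)^*) => s t.
have /orthomx_spectralP Aeq := An; rewrite {1}Aeq -/P -/D.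
rewrite invmx_unitary ?spectral_unitarymx// mxE; apply: eq_bigr => i _.
have sD : (sqrtC (D 0 i))^* = sqrtC (D 0 i).
  by apply: geC0_conj; rewrite sqrtC_ge0.
rewrite rmorphM /= conjCK sD mulrACA -expr2 sqrtCK mul_mx_diag !mxE.
by rewrite mulrA; congr (_ * _); rewrite mulrC.
Qed.

End Gram.

(** * Kernels that factor over the edges *)

Section EdgeKernels.
Variables (C : numClosedFieldType) (D Q : finType) (rev : D -> D) (pos : pred D).
Hypotheses (revK : involutive rev) (pos_rev : forall a, pos (rev a) = ~~ pos a).
Local Notation X := {ffun D -> Q}.
Implicit Types (x y : X) (a e : D) (s t : Q * Q) (T : {set D}).

Definition ends x a : Q * Q := (x a, x (rev a)).

Definition edge_kernel (P : D -> Q * Q -> Q * Q -> C) x y : C :=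
  \prod_(a | pos a) P a (ends x a) (ends y a).

Lemma card_pos : #|D| = (#|pos| + #|pos|)%N.
Proof.
rewrite -(cardC pos); congr (_ + _)%N.
rewrite -(card_imset pos (inv_inj revK)).
apply: eq_card => a; rewrite inE /= unfold_in.
apply/idP/imsetP => [Na|[b pb ->]]; last by rewrite pos_rev negbK.
by exists (rev a); rewrite ?revK// unfold_in pos_rev.
Qed.

Lemma ends_inj x y : (forall a, pos a -> ends x a = ends y a) -> x = y.
Proof.
move=> xy; apply/ffunP => a; have [pa|Na] := boolP (pos a).
  by have [] := xy a pa.
have /xy[_] : pos (rev a) by rewrite pos_rev.
by rewrite revK.
Qed.

(** An assignment to all darts amounts to a free choice of a pair for every positive dart, so the
    sum distributes over the product. *)
Lemma sum_prod_ends (f : D -> Q * Q -> C) :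
  \sum_x \prod_(a | pos a) f a (ends x a) = \prod_(a | pos a) \sum_s f a s.
Proof.
pose E := {a | pos a}.
pose g x : {ffun E -> Q * Q} := [ffun u => ends x (val u)].
have gI : injective g.
  move=> x y /ffunP gxy; apply: ends_inj => a pa.
  by have := gxy (exist _ a pa); rewrite !ffunE.
(* Counting suffices: there are twice as many darts as positive darts. *)
have gB : bijective g.
  apply: inj_card_bij gI _.
  by rewrite !card_ffun card_sig card_prod card_pos expnD -expnMn.
rewrite (big_sub pos (fun a => \sum_s f a s)) bigA_distr_bigA.
rewrite (reindex g) /=; last exact: onW_bij.
apply: eq_bigr => x _; rewrite (big_sub pos (fun a => f a (ends x a))).
by apply: eq_bigr => u _; rewrite ffunE.
Qed.

Lemma sum_edge_kernel P :
  \sum_x \sum_y edge_kernel P x y = \prod_(a | pos a) \sum_s \sum_t P a s t.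
Proof.
rewrite -(sum_prod_ends (fun a s => \sum_t P a s t)).
apply: eq_bigr => x _.
exact: (sum_prod_ends (fun a => P a (ends x a))).
Qed.

Lemma gram_edge_kernel P :
  (forall a, pos a -> gram (P a)) -> gram (edge_kernel P).
Proof.
move=> gP; apply: gram_prod => a pa.
exact: (gram_comp (fun x : X => ends x a) (gP a pa)).
Qed.

Definition flip e x : X :=
  [ffun a => if a == e then x (rev e) else if a == rev e then x e else x a].

Definition swap s : Q * Q := (s.2, s.1).

Lemma rev_neq a : (rev a == a) = false.
Proof. by apply/eqP => /(congr1 pos); rewrite pos_rev; case: pos. Qed.

Lemma ends_flip e x a : pos e -> pos a ->
  ends (flip e x) a = if a == e then swap (ends x e) else ends x a.
Proof.
move=> pe pa; rewrite /ends /swap !ffunE (inj_eq (inv_inj revK)).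
have [->|ae] := eqVneq a e; first by rewrite rev_neq.
have -> : (a == rev e) = false by apply/eqP => ae'; move: pa; rewrite ae' pos_rev pe.
have -> // : (rev a == e) = false by apply/eqP => ae'; move: pe; rewrite -ae' pos_rev pa.
Qed.

Lemma flipK e : involutive (flip e).
Proof.
move=> x; apply/ffunP => a; rewrite !ffunE !eqxx.
have [->|ae] := eqVneq a e; first by rewrite rev_neq.
by have [->|//] := eqVneq a (rev e).
Qed.

Variable k : C.
Hypotheses (k0 : 0 <= k) (k1 : k <= 1).

(* The kernel of the product of [1 - k F_a] over the edges [a] in [T], where
   [F_a] is the flip of [a]. *)
Definition flip_kernel T :=
  edge_kernel (fun a s t => (s == t)%:R - (a \in T)%:R * (k * (s == swap t)%:R)).

Lemma flip_kernel0 x y : flip_kernel finset.set0 x y = (x == y)%:R.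
Proof.
have [->|xy] := eqVneq x y.
  by apply: big1 => a _; rewrite eqxx inE mul0r subr0.
have [a pa Na] : exists2 a, pos a & ends x a != ends y a.
  apply/exists_inP; apply: contraNT xy => /exists_inPn xy.
  by apply/eqP/ends_inj => a pa; apply/eqP; have := xy a pa; rewrite negbK.
by rewrite /flip_kernel /edge_kernel (bigD1 a)//= (negPf Na) inE mul0r subr0 mul0r.
Qed.

Lemma flip_kernel_flip T e x y : pos e ->
  flip_kernel T (flip e x) (flip e y) = flip_kernel T x y.
Proof.
move=> pe; apply: eq_bigr => a pa; rewrite !ends_flip//.
have [->|//] := eqVneq a e; case: (ends x e) (ends y e) => [s1 s2] [t1 t2].
by rewrite /swap !xpair_eqE /= [(s2 == t2) && _]andbC [(s2 == t1) && _]andbC.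
Qed.

Lemma flip_kernelU1 T e x y : pos e -> e \notin T ->
  flip_kernel (e |: T) x y =
  flip_kernel T x y - k * flip_kernel T x (flip e y).
Proof.
move=> pe eT; rewrite /flip_kernel /edge_kernel.
rewrite [LHS](bigD1 e)//= [X in _ = X - _](bigD1 e)//=.
rewrite [X in _ = _ - _ * X](bigD1 e)//=.
rewrite ends_flip// eqxx setU11 (negPf eT) mul1r !mul0r !subr0.
rewrite mulrBl mulrA; congr (_ * _ - _ * _); apply: eq_bigr => a /andP[pa ae].
  by rewrite in_setU1 (negPf ae).
by rewrite in_setU1 ends_flip// (negPf ae).
Qed.

Definition flip_form T (K : X -> X -> C) := \sum_x \sum_y K x y * flip_kernel T x y.

Lemma sum2_flip e (F : X -> X -> C) :
  \sum_x \sum_y F (flip e x) (flip e y) = \sum_x \sum_y F x y.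
Proof.
rewrite [RHS](reindex_inj (inv_inj (flipK e))); apply: eq_bigr => x _.
by rewrite [RHS](reindex_inj (inv_inj (flipK e))).
Qed.

Lemma flip_formJ T e K : pos e ->
  flip_form T (fun x y => K (flip e x) (flip e y)) = flip_form T K.
Proof.
move=> pe; rewrite -[RHS](sum2_flip e); apply: eq_bigr => x _.
by apply: eq_bigr => y _; rewrite flip_kernel_flip.
Qed.

(** Reindexing [y] along the flip moves it from the kernel onto [K]. *)
Lemma flip_formU1 T e K : pos e -> e \notin T ->
  flip_form (e |: T) K =
  flip_form T K - k * flip_form T (fun x y => K x (flip e y)).
Proof.
move=> pe eT; rewrite /flip_form mulr_sumr -sumrB; apply: eq_bigr => x _.
rewrite [X in _ - _ * X](reindex_inj (inv_inj (flipK e))) mulr_sumr -sumrB.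
by apply: eq_bigr => y _; rewrite flip_kernelU1// flipK mulrBr mulrCA.
Qed.

(* With [F] the flip of [e], [1 - k F = (1 - k) + 2 k P] for the projector
   [P = (1 - F) / 2], which commutes with all the other flips. *)
Lemma flip_form_ge T K : gram K -> {subset T <= pos} ->
  (1 - k) ^+ #|T| * \sum_x K x x <= flip_form T K.
Proof.
(* [K] is generalised because the induction hypothesis is applied both to [K] and to its
   antisymmetrisation [L]. *)
have [n] := ubnP #|T|; elim: n T K => // n IH T K /ltnSE Tn gK Tpos.
have [T0|[e eT]] := set_0Vmem T.
  rewrite T0 cards0 mul1r /flip_form le_eqVlt; apply/orP; left; apply/eqP.
  apply: eq_bigr => x _; rewrite (bigD1 x)//= flip_kernel0 eqxx mulr1.
  rewrite big1 ?addr0// => y /negPf yx.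
  by rewrite flip_kernel0 eq_sym yx mulr0.
have pe : pos e := Tpos e eT.
have eT' : e \notin T :\ e by rewrite setD11.
have T'n : (#|T :\ e| < n)%N by move: Tn; rewrite (cardsD1 e) eT.
have T'pos : {subset T :\ e <= pos} by move=> a /setD1P[_ /Tpos].
rewrite -(finset.setD1K eT) flip_formU1// cardsU1 eT' exprS -mulrA.
set T' := T :\ e in eT' T'n T'pos *.
pose L x y := K x y - K x (flip e y) - K (flip e x) y + K (flip e x) (flip e y).
have gL : gram L := gram_anti (flip e) gK.
have L0 : 0 <= flip_form T' L.
  apply: le_trans (IH _ _ T'n gL T'pos); apply: mulr_ge0.
    by rewrite exprn_ge0// subr_ge0.
  by apply: sumr_ge0 => x _; exact: gram_diag_ge0.
have LE : flip_form T' L =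
    2 * flip_form T' K - 2 * flip_form T' (fun x y => K x (flip e y)).
  (* The kernel is invariant under a simultaneous flip, so a flip on both sides disappears and a
     flip on one side may be moved to the other. *)
  have E1 : flip_form T' (fun x y => K (flip e x) (flip e y)) = flip_form T' K.
    exact: flip_formJ.
  have E2 : flip_form T' (fun x y => K (flip e x) y) =
            flip_form T' (fun x y => K x (flip e y)).
    rewrite -(flip_formJ T' (fun x y => K x (flip e y)) pe).
    by apply: eq_bigr => x _; apply: eq_bigr => y _; rewrite flipK.
  rewrite !mulr_natl !mulr2n -{2}E1 -{2}E2 /flip_form -!big_split -sumrB/=.
  apply: eq_bigr => x _; rewrite -!big_split -sumrB /=.
  by apply: eq_bigr => y _; rewrite /L; ring.
have := IH _ _ T'n gK T'pos.
move/(ler_wpM2l (_ : 0 <= 1 - k)); rewrite subr_ge0 => /(_ k1) IHK.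
apply: le_trans IHK _; rewrite -subr_ge0.
set u := flip_form T' K in LE *.
set v := flip_form T' (fun x y => K x (flip e y)) in LE *.
have -> : u - k * v - (1 - k) * u = k * (2^-1 * flip_form T' L).
  by rewrite LE; field.
by rewrite !mulr_ge0// invr_ge0.
Qed.

End EdgeKernels.

(** * Cuts and the witness *)

Section Entries.
Variables (R : realType) (T : finType).
Implicit Types (A : op R T).

Lemma entry_mkop (f : T -> T -> R[i]) s t : entry (mkop f) s t = f s t.
Proof. by rewrite /entry /mkop mxE !enum_rankK. Qed.

Lemma mxtrace_entry A : \tr A = \sum_t entry A t t.
Proof.
rewrite /mxtrace (reindex (@enum_rank T)) //=.
by apply: onW_bij; exact: enum_rank_bij.
Qed.

Lemma density_gram A : density A -> gram (entry A).
Proof. by move=> [_ /psd_gram gA]; exact: (gram_comp enum_rank gA). Qed.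

Lemma gram_density A : gram (entry A) -> \sum_t entry A t t = 1 -> density A.
Proof.
move=> gA trA; split; first by rewrite mxtrace_entry.
move=> v; have := gram_ge0 (fun t => v (enum_rank t) 0) gA; congr (_ <= _).
rewrite mxE exchange_big /= [RHS](reindex (@enum_rank T)) /=; last first.
  by apply: onW_bij; exact: enum_rank_bij.
apply: eq_bigr => t _; rewrite mxE big_distrl /=.
rewrite [RHS](reindex (@enum_rank T)) /=; last first.
  by apply: onW_bij; exact: enum_rank_bij.
by apply: eq_bigr => s _; rewrite !mxE.
Qed.

End Entries.

(** * The complementary projector of [Phi] on a single edge *)

Section MaximallyEntangled.
Variables (C : numClosedFieldType) (d : nat).
Hypothesis d0 : (0 < d)%N.
Local Notation Q := ('I_d * 'I_d)%type.
Local Notation k := (d%:R^-1 : C).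
Implicit Types s t u : Q.

(** The unnormalised maximally entangled vector; [Phi] has kernel [k * (diag s * diag t)]. *)
Definition diag s : C := (s.1 == s.2)%:R.

Lemma diag_sqr s : diag s * diag s = diag s.
Proof. by rewrite /diag -natrM mulnb andbb. Qed.

Lemma sum_diag : \sum_s diag s = d%:R.
Proof.
rewrite -(pair_big xpredT xpredT (fun i j => diag (i, j))) /=.
transitivity (\sum_(i < d) (1 : C)); last by rewrite sumr_const card_ord.
apply: eq_bigr => i _; rewrite (bigD1 i)//= /diag /= eqxx big1 ?addr0// => j.
by rewrite eq_sym => /negPf ->.
Qed.

Lemma sum_delta s (F : Q -> C) : \sum_t (s == t)%:R * F t = F s.
Proof.
rewrite (bigD1 s)//= eqxx mul1r big1 ?addr0// => t /negPf.
by rewrite eq_sym => ->; rewrite mul0r.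
Qed.

Lemma dC_neq0 : d%:R != 0 :> C. Proof. by rewrite pnatr_eq0 -lt0n. Qed.

(* [1 - Phi] if [b], and the identity otherwise. *)
Definition cut_projector (b : bool) s t : C :=
  (s == t)%:R - b%:R * (k * (diag s * diag t)).

(** A Hermitian projector [P] is [P] times its adjoint, so its own columns are the factors;
    idempotence comes from [sum_diag] cancelling one [k]. *)
Lemma gram_cut_projector b : gram (cut_projector b).
Proof.
case: b; last first.
  by apply: eq_gram (gram_delta C Q) => s t; rewrite /cut_projector mul0r subr0.
exists Q, (fun u s => cut_projector true s u) => s t.
have conjP u : (cut_projector true t u)^* = cut_projector true u t.
  rewrite /cut_projector /diag rmorphB !rmorphM /= fmorphV !rmorph_nat.
  by rewrite eq_sym [_ * (t.1 == _)%:R]mulrC.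
under eq_bigr do rewrite conjP.
transitivity (\sum_u ((s == u)%:R * cut_projector true u t
   - (t == u)%:R * (k * diag s * diag u)
   + k * diag s * (k * diag t) * (diag u * diag u))).
  rewrite big_split sumrB !sum_delta -mulr_sumr /=.
  rewrite (eq_bigr _ (fun u _ => diag_sqr u)) sum_diag /cut_projector.
  by field; exact: dC_neq0.
apply: eq_bigr => u _; rewrite /cut_projector [t == u]eq_sym /=.
by ring.
Qed.

(** With [b] true this is the trace of [A d Phi + B] against [1 - Phi]; with [b] false, its plain
    trace. *)
Lemma sum_cut_projector (b : bool) (A B : C) :
  \sum_s \sum_t (A * (diag s * diag t) + B * (s == t)%:R) * cut_projector b s t =
  A * d%:R + B * d%:R ^+ 2 - b%:R * (A * d%:R + B).
Proof.
transitivity (\sum_s (A * diag s + B - b%:R * (k * B * diag s)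
                      - b%:R * (k * A * diag s * d%:R))).
  apply: eq_bigr => s _.
  transitivity (\sum_t ((s == t)%:R *
        (A * (diag s * diag t) + B - b%:R * (k * B * (diag s * diag t)))
      - b%:R * (k * A * (diag s * diag s)) * (diag t * diag t))).
    apply: eq_bigr => t _; rewrite /cut_projector.
    by have [->|_] := eqVneq s t; rewrite /=; ring.
  rewrite sumrB sum_delta -mulr_sumr (eq_bigr _ (fun u _ => diag_sqr u)).
  by rewrite sum_diag !diag_sqr; ring.
rewrite !sumrB big_split /= -!mulr_sumr -!mulr_suml -!mulr_sumr sum_diag.
rewrite sumr_const card_prod card_ord -[B *+ _]mulr_natr natrM.
by field; exact: dC_neq0.
Qed.

End MaximallyEntangled.

(** * Partial transposition across a cut, and the witness *)

Section Cut.
Variables (R : realType) (d : nat) (V D : finType) (own : D -> V).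
Variables (rev : D -> D) (pos : pred D).
Hypotheses (revK : involutive rev) (pos_rev : forall a, pos (rev a) = ~~ pos a).
Local Notation C := R[i].
Local Notation X := {ffun D -> 'I_d}.
Hypothesis d0 : (0 < d)%N.
Local Notation k := (d%:R^-1 : C).
Implicit Types (S : {set V}) (x y : X) (K L : op R X).

Definition crossing S a := (own a \in S) != (own (rev a) \in S).

Definition ncross S : nat := #|[set a | pos a & crossing S a]%SET|.

Definition cut_kernel S : X -> X -> C :=
  edge_kernel rev pos (fun a => cut_projector C (crossing S a)).

(** This is the trace of [F] against [Pi_S]; no transpose appears because the kernel of [Pi_S] is
    symmetric. *)
Definition cut_form S (F : X -> X -> C) := \sum_x \sum_y F x y * cut_kernel S x y.

Definition mix S x y : X := [ffun a => if own a \in S then x a else y a].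

Lemma mixK S x y : mix S (mix S x y) (mix S y x) = x.
Proof. by apply/ffunP => a; rewrite !ffunE; case: (own a \in S). Qed.

Lemma restrict_mix S x y : Defs.restrict own S (mix S x y) = Defs.restrict own S x.
Proof. by apply/ffunP => u; rewrite !ffunE (valP u). Qed.

Lemma restrict_mixC S x y :
  Defs.restrict own (~: S) (mix S x y) = Defs.restrict own (~: S) y.
Proof.
apply/ffunP => u; rewrite !ffunE; have := valP u.
by rewrite finset.in_setC => /negPf ->.
Qed.

Lemma sum2_mix S (F : X -> X -> C) :
  \sum_x \sum_y F (mix S x y) (mix S y x) = \sum_x \sum_y F x y.
Proof.
rewrite !pair_big /=; pose g (z : X * X) := (mix S z.1 z.2, mix S z.2 z.1).
have gK : involutive g by move=> [x y]; rewrite /g /= !mixK.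
by rewrite [RHS](reindex_inj (inv_inj gK)).
Qed.

(** Edge by edge: a non-crossing edge carries the identity, which transposition fixes; on a crossing
    edge the two [diag] constraints become equality up to a swap. *)
Lemma cut_kernel_mix S x y :
  cut_kernel S (mix S x y) (mix S y x) =
  flip_kernel rev pos k [set a | pos a & crossing S a]%SET x y.
Proof.
apply: eq_bigr => a pa; rewrite inE pa /= /cut_projector /diag.
rewrite -natrM mulnb /ends /swap /crossing !ffunE.
case: (own a \in S); case: (own (rev a) \in S); rewrite /= ?mul0r// !xpair_eqE /=.
- by rewrite [y (rev a) == x _]eq_sym [y a == x _]eq_sym.
- by rewrite [y a == x a]eq_sym [y a == x (rev a)]eq_sym [(x (rev a) == y a) && _]andbC.
- by rewrite [y a == x a]eq_sym [y (rev a) == x _]eq_sym.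
Qed.

Lemma sum_restrict S (f : {ffun held own S -> 'I_d} -> C)
    (g : {ffun held own (~: S) -> 'I_d} -> C) :
  \sum_x f (Defs.restrict own S x) * g (Defs.restrict own (~: S) x) =
  (\sum_u f u) * (\sum_v g v).
Proof.
rewrite big_distrlr pair_big /=.
pose h x := (Defs.restrict own S x, Defs.restrict own (~: S) x).
have hI : injective h.
  move=> x y [/ffunP xy1 /ffunP xy2]; apply/ffunP => a.
  have [aS|aS] := boolP (own a \in S).
    by have := xy1 (exist _ a aS); rewrite !ffunE.
  have aS' : own a \in ~: S by rewrite finset.in_setC.
  by have := xy2 (exist _ a aS'); rewrite !ffunE.
have hB : bijective h.
  apply: inj_card_bij hI _.
  rewrite card_prod !card_ffun -expnD !card_sig.
  rewrite -(cardC [pred a | own a \in S]); apply: eq_leq; congr (_ ^ (_ + _))%N.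
  by apply: eq_card => a; rewrite !inE.
by rewrite [RHS](reindex h) //=; exact: onW_bij.
Qed.

Lemma product_gram S K : product_across own S K -> gram (entry K).
Proof.
move=> [A [B [/density_gram gA /density_gram gB ->]]].
apply: (@eq_gram _ _ (fun x y => entry A (Defs.restrict own S x) (Defs.restrict own S y) *
    entry B (Defs.restrict own (~: S) x) (Defs.restrict own (~: S) y))).
  by move=> x y; rewrite entry_mkop.
apply: gramM; first exact: (gram_comp (Defs.restrict own S) gA).
exact: (gram_comp (Defs.restrict own (~: S)) gB).
Qed.

(* Exchanging the entries of [x] and [y] outside [S] is the partial transpose;
   it turns [Phi] into [1/d] times the flip. *)
Lemma cut_form_product S K : product_across own S K ->
  (1 - k) ^+ ncross S <= cut_form S (entry K).
Proof.
move=> [A [B [dA dB ->]]].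
have [gA gB] := (density_gram dA, density_gram dB).
pose K' x y := entry A (Defs.restrict own S x) (Defs.restrict own S y) *
               entry B (Defs.restrict own (~: S) y) (Defs.restrict own (~: S) x).
have gK' : gram K'.
  apply: gramM; first exact: (gram_comp (Defs.restrict own S) gA).
  exact: (gram_comp (Defs.restrict own (~: S)) (gram_tr gB)).
have tr1 : \sum_x K' x x = 1.
  rewrite (sum_restrict (fun u => entry A u u) (fun v => entry B v v)).
  by rewrite -!mxtrace_entry dA.1 dB.1 mulr1.
have k0 : 0 <= k by rewrite invr_ge0.
have k1 : k <= 1 by rewrite invf_le1 ?ltr0n// ler1n.
rewrite /cut_form -(sum2_mix S).
have := flip_form_ge revK pos_rev k0 k1 gK' (T := [set a | pos a & crossing S a]%SET).
rewrite tr1 mulr1 -/(ncross S); set L := flip_form _ _ _ _ _; set L' := \sum_x _.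
suff -> : L' = L by apply; move=> a; rewrite inE => /andP[].
apply: eq_bigr => x _; apply: eq_bigr => y _.
by rewrite cut_kernel_mix entry_mkop !restrict_mix !restrict_mixC.
Qed.

Lemma cut_form_ge0 S (F : X -> X -> C) : gram F -> 0 <= cut_form S F.
Proof.
move=> gF; apply: gram_sum_ge0; apply: gramM gF _.
by apply: gram_edge_kernel => a _; exact: gram_cut_projector.
Qed.

Lemma cut_form_mixture S m (w : 'I_m -> R) (B : 'I_m -> op R X) :
  cut_form S (entry (\sum_i (w i)%:C%C *: B i)) =
  \sum_i (w i)%:C%C * cut_form S (entry (B i)).
Proof.
under [RHS]eq_bigr do rewrite /cut_form mulr_sumr.
rewrite exchange_big; apply: eq_bigr => x _.
under [RHS]eq_bigr do rewrite mulr_sumr.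
rewrite exchange_big; apply: eq_bigr => y _.
rewrite /entry summxE mulr_suml; apply: eq_bigr => i _.
by rewrite mxE mulrA.
Qed.

Lemma mixture_gram (P : op R X -> Prop) K :
  (forall L, P L -> gram (entry L)) -> mixture P K -> gram (entry K).
Proof.
move=> gP [m [w [B [w0 _ PB ->]]]].
apply: (@eq_gram _ _ (fun x y => \sum_i (w i)%:C%C * entry (B i) x y)).
  by move=> x y; rewrite /entry summxE; apply: eq_bigr => i _; rewrite mxE.
by apply: gram_sum => i; apply: gramZ; [rewrite lecR | exact: gP].
Qed.

(** Affine lower bounds pass to mixtures. This is applied at both levels of biseparability: mixtures
    of products across one cut, and mixtures over cuts. *)
Lemma mixture_ge (P : op R X -> Prop) (phi : op R X -> C) (c : C) K :
  (forall m (w : 'I_m -> R) B,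
     phi (\sum_i (w i)%:C%C *: B i) = \sum_i (w i)%:C%C * phi (B i)) ->
  (forall L, P L -> c <= phi L) -> mixture P K -> c <= phi K.
Proof.
move=> phiE cP [m [w [B [w0 w1 PB ->]]]]; rewrite phiE.
have -> : c = \sum_i (w i)%:C%C * c.
  by rewrite -mulr_suml -rmorph_sum w1 mul1r.
by apply: ler_sum => i _; rewrite ler_wpM2l ?lecR ?cP.
Qed.

Lemma separable_gram S K : separable_across own S K -> gram (entry K).
Proof. by apply: mixture_gram => L; exact: product_gram. Qed.

Definition witness K : C :=
  \sum_(S : {set V} | (S != finset.set0) && (S != [set: V]%SET))
    (1 - k) ^- ncross S * cut_form S (entry K).

Lemma witness_biseparable K : (1 < d)%N -> biseparable own K -> 1 <= witness K.
Proof.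
move=> d1; have k1 : 0 < 1 - k.
  by rewrite subr_gt0 invf_lt1 ?ltr0n// ltr1n.
apply: mixture_ge => [m w B|L [S [S0 ST sepL]]].
  under [RHS]eq_bigr do rewrite mulr_sumr.
  rewrite exchange_big; apply: eq_bigr => S _.
  rewrite cut_form_mixture mulr_sumr; apply: eq_bigr => i _.
  by rewrite mulrCA.
have gL := separable_gram sepL.
(* The cut across which [L] is separable already contributes [1]; all other terms are nonnegative
   because [Pi_S'] is positive. *)
rewrite /witness (bigD1 S) ?S0//= -[leLHS]addr0; apply: lerD; last first.
  apply: sumr_ge0 => S' _; apply: mulr_ge0; last exact: cut_form_ge0.
  by rewrite invr_ge0 exprn_ge0// ltW.
rewrite -[leLHS](mulVf (lt0r_neq0 (exprn_gt0 (ncross S) k1))).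
rewrite ler_wpM2l ?invr_ge0 ?exprn_ge0 ?(ltW k1)//.
apply: (mixture_ge (phi := fun L => cut_form S (entry L))) sepL.
  by move=> m w B; exact: cut_form_mixture.
by move=> A; exact: cut_form_product.
Qed.

End Cut.

(** * Counting crossing edges *)

Section Darts.
Variable G : network.
Implicit Types (a : dart G) (S : {set G}).

Lemma rev_dartK : involutive (@rev_dart G).
Proof. by move=> a; apply: val_inj; case: a => [[]]. Qed.

Lemma positive_rev a : positive (rev_dart a) = ~~ positive a.
Proof.
case: a => [[u v] /= uv]; rewrite /positive /= -leqNgt ltn_neqAle.
by case: eqP => // e; have vu := enum_rank_inj (ord_inj e); move: uv; rewrite vu adj_irr.
Qed.

Local Notation ncross := (ncross (@holder G) (@rev_dart G) (@positive G)).

Lemma ncrossC S : ncross (~: S) = ncross S.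
Proof.
apply: eq_card => a; rewrite !inE /crossing !finset.in_setC.
by rewrite (inj_eq negb_inj).
Qed.

(** Send an outgoing dart to the positive dart of its edge. This is injective because a dart and its
    reverse cannot both leave [S]. *)
Lemma ncross_outgoing S :
  (#|[set a : dart G | (holder a \in S) && (holder (rev_dart a) \notin S)]%SET|
   <= ncross S)%N.
Proof.
pose f a := if positive a then a else rev_dart a.
set O := finset _.
have fI : {in O &, injective f}.
  move=> a b; rewrite !inE /f => /andP[aS raS] /andP[bS rbS].
  case: ifP; case: ifP => _ _ //.
  - by move=> ab; move: raS; rewrite ab rev_dartK bS.
  - by move=> ab; move: rbS; rewrite -ab rev_dartK aS.
  - by move/(inv_inj rev_dartK).
rewrite -(card_in_imset fI); apply: subset_leq_card.
apply/fintype.subsetP => _ /imsetP[a + ->]; rewrite !inE /f => /andP[aS /negPf raS].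
by case: ifP => pa; rewrite ?positive_rev pa /crossing ?rev_dartK aS raS.
Qed.

(** A party in [S] has at most [#|S|] neighbours inside [S], so at least [delta - #|S|] of its edges
    leave [S]. *)
Lemma ncross_ge S (delta : nat) : (forall v : G, delta <= deg v)%N ->
  (#|S| * (delta - #|S|) <= ncross S)%N.
Proof.
move=> dG; apply: leq_trans (ncross_outgoing S).
have -> : #|[set a : dart G | (holder a \in S) && (holder (rev_dart a) \notin S)]%SET| =
    (\sum_(v in S) #|[set u | adj v u & u \notin S]%SET|)%N.
  rewrite -sum1_card big_mkcond /=.
  transitivity (\sum_(z : G * G | adj z.1 z.2) ((z.1 \in S) && (z.2 \notin S) : nat))%N.
    rewrite (big_sub (fun z : G * G => adj z.1 z.2)).
    by apply: eq_bigr => a _; rewrite inE; case: ifP.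
  rewrite big_mkcond /=.
  rewrite -(pair_big xpredT xpredT (fun v u : G =>
    if adj v u then ((v \in S) && (u \notin S) : nat) else 0%N)) /=.
  rewrite [RHS]big_mkcond; apply: eq_bigr => v _.
  case: ifP => vS; last by apply: big1 => u _; case: ifP.
  rewrite -sum1_card [RHS]big_mkcond; apply: eq_bigr => u _; rewrite inE.
  by case: adj; case: (u \in S).
rewrite -sum_nat_const; apply: leq_sum => v _.
have := dG v; rewrite /deg -(cardsID S) => dv.
rewrite leq_subLR; apply: leq_trans dv _; apply: leq_add.
  by apply: subset_leq_card; exact: subsetIr.
by apply: eq_leq; apply: eq_card => u; rewrite !inE andbC.
Qed.

End Darts.

Lemma sum_exp_card (R : comNzRingType) (T : finType) (q : R) :
  \sum_(S : {set T}) q ^+ #|S| = (1 + q) ^+ #|T|.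
Proof.
rewrite addrC -prodr_const bigA_distr; apply: eq_bigr => S _.
by rewrite -big_mkcond /= prodr_const.
Qed.

Lemma sum_cuts_le (R : realFieldType) (G : network) (delta b : nat) (r : R) :
  0 <= r -> r <= 1 -> (forall v : G, delta <= deg v)%N ->
  (#|G| + b.*2 <= delta.*2)%N ->
  \sum_(S : {set G} | (S != finset.set0) && (S != [set: G]%SET))
     r ^+ ncross (@holder G) (@rev_dart G) (@positive G) S <=
  2 * ((1 + r ^+ b) ^+ #|G| - 1).
Proof.
move=> r0 r1 dG Gb; set n := ncross _ _ _; set q := r ^+ b.
have q0 : 0 <= q by rewrite exprn_ge0.
(* For such [S] the degree bound gives [delta - #|S| >= b], hence at least [b * #|S|] crossing
   edges. *)
have small (S : {set G}) : (#|S| * 2 <= #|G|)%N -> r ^+ n S <= q ^+ #|S|.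
  move=> SG; rewrite -exprM; apply: ler_wiXn2l => //.
  apply: leq_trans (ncross_ge S dG).
  rewrite mulnC leq_mul2l; apply/orP; right; lia.
(* A cut and its complement have the same crossing edges, so the smaller side supplies the bound;
   adding both powers avoids splitting the sum. *)
apply: (@le_trans _ _ (\sum_(S : {set G} | (S != finset.set0) && (S != [set: G]%SET))
     (q ^+ #|S| + q ^+ #|~: S|))).
  apply: ler_sum => S _; case: (leqP (#|S| * 2) #|G|) => SG.
    by rewrite -[leLHS]addr0 lerD ?small ?exprn_ge0.
  rewrite -[leLHS]add0r lerD ?exprn_ge0// /n -ncrossC.
  by apply: small; have := cardsC S; lia.
rewrite big_split /= mulr_natl mulr2n.
have E : \sum_(S : {set G} | S != finset.set0) q ^+ #|S| = (1 + q) ^+ #|G| - 1.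
  rewrite -sum_exp_card [X in _ = X - _](bigD1 finset.set0) //= cards0 expr0.
  by rewrite [RHS]addrAC subrr add0r.
have sub (P P' : pred {set G}) (F : {set G} -> R) : (forall S, 0 <= F S) ->
    (forall S, P S -> P' S) -> \sum_(S | P S) F S <= \sum_(S | P' S) F S.
  move=> F0 PP'; rewrite [leLHS]big_mkcond [leRHS]big_mkcond /=; apply: ler_sum => S _.
  by case: ifP => [/PP' ->//|_]; case: ifP.
apply: lerD.
  by rewrite -E; apply: sub => [S|S /andP[]//]; rewrite exprn_ge0.
rewrite -E (reindex_inj (@finset.setC_inj G)) /=.
under eq_bigr do rewrite finset.setCK.
apply: sub => [S|S]; first by rewrite exprn_ge0.
by rewrite -finset.setC0 (inj_eq (@finset.setC_inj _)) => /andP[].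
Qed.

(** * The witness on the IPEN state *)

Section IsotropicNetwork.
Variables (R : realType) (d : nat) (p : R) (G : network).
Hypotheses (d1 : (1 < d)%N) (p0 : 0 <= p) (p1 : p <= 1).
Local Notation C := R[i].
Local Notation k := (d%:R^-1 : C).
Local Notation P := (p%:C%C : C).
Local Notation rev := (@rev_dart G).
Local Notation pos := (@positive G).
Implicit Types s t : 'I_d * 'I_d.

Let d0 : (0 < d)%N. Proof. exact: ltnW. Qed.

Lemma entry_isotropic s t :
  entry (isotropic d p) s t =
  P * k * (diag C s * diag C t) + (1 - P) * k ^+ 2 * (s == t)%:R.
Proof.
rewrite /entry /isotropic /Phi_plus /phi_plus !mxE big_ord1 !mxE !enum_rankK.
rewrite (inj_eq enum_rank_inj); congr (_ + _).
  rewrite -mulrA; congr (_ * _).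
  set z := ((Num.sqrt d%:R)^-1)%:C%C : C.
  have zz : z * z^* = k.
    rewrite geC0_conj; last by rewrite lecR invr_ge0 sqrtr_ge0.
    rewrite /z -rmorphM -invfM -expr2 sqr_sqrtr ?ler0n//.
    by rewrite fmorphV rmorph_nat.
  rewrite /diag; case: eqP => _; case: eqP => _.
  - by rewrite zz !mulr1.
  - by rewrite rmorph0 !mulr0.
  - by rewrite !mul0r mulr0.
  - by rewrite !mul0r mulr0.
by rewrite rmorphM fmorphV rmorphXn rmorph_nat rmorphB rmorph1 exprVn.
Qed.

Lemma gram_isotropic : gram (entry (isotropic d p)).
Proof.
apply: (eq_gram (fun s t => esym (entry_isotropic s t))).
apply: gramD; last first.
  apply: gramZ (gram_delta C _).
  rewrite mulr_ge0 ?exprn_ge0 ?invr_ge0 ?ler0n//.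
  by rewrite -(rmorph1 (real_complex R)) subr_ge0 lecR.
apply: gramZ; first by rewrite mulr_ge0 ?invr_ge0 ?ler0n// lecR.
exists unit, (fun _ => @diag C d) => s t.
by rewrite big_const card_unit /= addr0 rmorph_nat.
Qed.

Lemma entry_IPEN x y : entry (IPEN d p G) x y =
  edge_kernel rev pos (fun _ => entry (isotropic d p)) x y.
Proof. exact: entry_mkop. Qed.

Lemma density_IPEN : density (IPEN d p G).
Proof.
apply: gram_density.
  apply: (eq_gram (fun x y => esym (entry_IPEN x y))).
  by apply: gram_edge_kernel => a _; exact: gram_isotropic.
under eq_bigr do rewrite entry_IPEN.
rewrite (sum_prod_ends (@rev_dartK G) (@positive_rev G)
  (fun _ s => entry (isotropic d p) s s)).
(* With [false] the projector is the identity, so the formula computes the trace of one edge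
   state. *)
apply: big1 => a _; have := sum_cut_projector d0 false (P * k) ((1 - P) * k ^+ 2).
rewrite mul0r subr0; set rhs := (X in _ = X -> _).
have -> : rhs = 1 by rewrite /rhs; field; exact: dC_neq0.
move=> <-; apply: eq_bigr => s _.
rewrite (bigD1 s)//= big1 ?addr0; last first.
  move=> t /negPf ts; rewrite /cut_projector eq_sym ts mul0r subr0.
  by rewrite mulr0.
by rewrite /cut_projector eqxx mul0r subr0 mulr1 entry_isotropic eqxx.
Qed.

(** The trace factors over the edges: a non-crossing edge gives [1], and a crossing edge gives the
    weight of its state off [Phi], namely [(1 - p) (1 - 1/d^2)]. *)
Lemma cut_form_IPEN (S : {set G}) :
  cut_form (@holder G) rev pos S (entry (IPEN d p G)) =
  ((1 - P) * (1 + k) * (1 - k)) ^+ ncross (@holder G) rev pos S.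
Proof.
pose F a s t := entry (isotropic d p) s t *
  cut_projector C (crossing (@holder G) rev S a) s t.
transitivity (\sum_x \sum_y edge_kernel rev pos F x y).
  apply: eq_bigr => x _; apply: eq_bigr => y _.
  by rewrite entry_IPEN /cut_kernel /edge_kernel -big_split.
rewrite (sum_edge_kernel (@rev_dartK G) (@positive_rev G)).
rewrite /ncross -prodr_const [RHS]big_mkcond [LHS]big_mkcond /=.
apply: eq_bigr => a _; rewrite inE; case: (positive a) => //=.
under eq_bigr do under eq_bigr do rewrite /F entry_isotropic.
rewrite sum_cut_projector//.
by case: crossing; rewrite /=; field; exact: dC_neq0.
Qed.

Lemma witness_IPEN :
  witness (@holder G) rev pos (IPEN d p G) =
  (\sum_(S : {set G} | (S != finset.set0) && (S != [set: G]%SET))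
     ((1 - p) * (1 + d%:R^-1)) ^+ ncross (@holder G) rev pos S)%:C%C.
Proof.
rewrite /witness rmorph_sum; apply: eq_bigr => S _.
have k1 : 1 - k != 0.
  by rewrite subr_eq0 eq_sym invr_eq1 pnatr_eq1 gtn_eqF.
rewrite cut_form_IPEN exprMn mulrC mulfK ?expf_neq0//.
by rewrite rmorphXn rmorphM rmorphB rmorphD fmorphV rmorph_nat rmorph1.
Qed.

Lemma GME_IPEN :
  \sum_(S : {set G} | (S != finset.set0) && (S != [set: G]%SET))
     ((1 - p) * (1 + d%:R^-1)) ^+ ncross (@holder G) rev pos S < 1 ->
  GME (@holder G) (IPEN d p G).
Proof.
move=> lt1; split; first exact: density_IPEN.
move=> /(witness_biseparable (@rev_dartK G) (@positive_rev G) d0 d1).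
by rewrite witness_IPEN -(rmorph1 (real_complex R)) lecR leNgt lt1.
Qed.

End IsotropicNetwork.

(** * Asymptotics *)

Local Open Scope classical_set_scope.
Local Open Scope ring_scope.

Lemma bernoulli_ge (R : realFieldType) (x : R) n :
  -1 <= x -> 1 + n%:R * x <= (1 + x) ^+ n.
Proof.
move=> x1; elim: n => [|n IH]; first by rewrite mul0r addr0 expr0.
have := ler_wpM2l (_ : 0 <= 1 + x) IH.
rewrite -exprS => /(_ ltac:(lra)); apply: le_trans.
rewrite -natr1; have : 0 <= n%:R * x ^+ 2 by rewrite mulr_ge0// sqr_ge0.
nra.
Qed.

(** The lower limit is the supremum of the tail infima, so one of these exceeds [c]; [e] is the
    excess. *)
Lemma limn_inf_gt (R : realType) (u : R^nat) (c : R) :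
  (forall n, 0 <= u n <= 1) -> c < limn_inf u ->
  exists2 e, 0 < e & \forall n \near \oo, c + e <= u n.
Proof.
move=> u01; rewrite limn_infE; last first.
  exists 1; split; [exact: num_real|move=> x x1 n _].
  by have /andP[u0 u1] := u01 n; rewrite /= ger0_norm// (le_trans u1)// ltW.
move=> /sup_gt[|y [N _ <-] cy].
  exists (infs u 0%N); by exists 0%N.
exists ((infs u N - c)); first by rewrite subr_gt0.
exists N => // n /= Nn; rewrite addrC subrK.
apply: ge_inf; last by exists n.
by exists 0 => _ [m _ <-]; have /andP[] := u01 m.
Qed.

(** Bernoulli gives [(1 - q)^n >= 1 - n q > 2/3], and [(1 + q)^n (1 - q)^n <= 1], so
    [(1 + q)^n < 3/2]. *)
Lemma exp_one_plus_lt (R : realFieldType) (q : R) n :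
  0 <= q -> 3 * (n%:R * q) < 1 -> 2 * ((1 + q) ^+ n - 1) < 1.
Proof.
move=> q0; case: n => [_|n nq]; first by rewrite expr0 subrr mulr0.
have q1 : q <= 1.
  have : q <= n.+1%:R * q by rewrite ler_peMl// ler1n.
  lra.
have Y := bernoulli_ge n.+1 (_ : -1 <= - q).
have {}Y := Y ltac:(lra).
have XY : (1 + q) ^+ n.+1 * (1 - q) ^+ n.+1 <= 1.
  by rewrite -exprMn exprn_ile1//; nra.
have X0 : 0 <= (1 + q) ^+ n.+1 by rewrite exprn_ge0// addr_ge0.
move: Y XY X0; set X := (1 + q) ^+ n.+1; set Y := (1 - q) ^+ n.+1 => Y1 XY X0.
rewrite mulrN in Y1; nra.
Qed.

Lemma mulr_expr_lt1 (R : realType) (r K : R) : 0 <= r -> r < 1 -> 0 < K ->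
  exists b0, forall b, (b0 <= b)%N -> K * (b.+1%:R * r ^+ b) < 1.
Proof.
(* Since [r <= s^2], one factor [s^b] can absorb [b + 1] while the other tends to zero. The midpoint
   keeps [s] invertible even when [r = 0]. *)
move=> r0 r1 K0; pose s := Num.sqrt ((1 + r) / 2).
have s2 : s ^+ 2 = (1 + r) / 2 by rewrite sqr_sqrtr//; lra.
have s0 : 0 < s by rewrite sqrtr_gt0; lra.
have s1 : s < 1 by rewrite -sqrtr1 ltr_sqrt//; lra.
pose h := s^-1 - 1.
have h0 : 0 < h by rewrite subr_gt0 invf_gt1.
(* Chosen so that [b + 1 <= L (1 + b h)], where Bernoulli bounds [1 + b h] by [s^-b]. *)
pose L := 1 + h^-1.
have L0 : 0 < L by rewrite addr_gt0// invr_gt0.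
have bs b : b.+1%:R * s ^+ b <= L.
  have : 1 + b%:R * h <= s^-1 ^+ b.
    by have := bernoulli_ge b (_ : -1 <= h) => /(_ ltac:(lra)); rewrite /h subrKC.
  rewrite exprVn => hb.
  have : s ^+ b * (1 + b%:R * h) <= 1.
    by rewrite -ler_pdivlMl ?exprn_gt0// mulr1.
  move=> /(ler_wpM2l (ltW L0)); rewrite mulr1; apply: le_trans.
  rewrite mulrCA mulrC ler_pM2l ?exprn_gt0//.
  have -> : L * (1 + b%:R * h) = b.+1%:R + b%:R * h + h^-1.
    by rewrite -natr1 /L; field; rewrite gt_eqF.
  by rewrite -addrA lerDl addr_ge0 ?invr_ge0 ?mulr_ge0// ltW.
have /cvgr_lt /(_ (K * L)^-1) : GRing.exp s @ \oo --> 0.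
  by apply: cvg_expr; rewrite ger0_norm// ltW.
rewrite invr_gt0 mulr_gt0// => /(_ isT) [b0 _ sb].
exists b0 => b /sb; rewrite /= -div1r ltr_pdivlMr ?mulr_gt0//.
apply: le_lt_trans; rewrite [leRHS]mulrC -mulrA ler_pM2l//.
apply: (@le_trans _ _ (b.+1%:R * (s ^+ b * s ^+ b))).
  rewrite ler_wpM2l// -exprMn; apply: lerXn2r; rewrite ?nnegrE ?mulr_ge0 ?(ltW s0)//.
  by rewrite -expr2 s2; lra.
by rewrite mulrA ler_wpM2r ?exprn_ge0// ltW.
Qed.

Lemma eventually_sum_cuts_lt1 (R : realType) (r : R) (M : nat) :
  0 <= r -> r < 1 -> (0 < M)%N ->
  exists N0, forall N, (N0 <= N)%N -> 2 * ((1 + r ^+ (N %/ M)) ^+ N - 1) < 1.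
Proof.
move=> r0 r1 M0.
have [b0 Hb] := mulr_expr_lt1 r0 r1 (ltac:(rewrite mulr_gt0 ?ltr0n//) : 0 < 3 * M%:R).
(* Beyond this threshold [N %/ M >= b0], and [N] is replaced by its upper bound [M (N %/ M + 1)]. *)
exists (b0 * M)%N => N NM; apply: exp_one_plus_lt; first by rewrite exprn_ge0.
have := Hb (N %/ M)%N; rewrite leq_divRL// => /(_ NM).
apply: le_lt_trans; rewrite -[leRHS]mulrA ler_pM2l//.
rewrite mulrA ler_wpM2r ?exprn_ge0//.
by rewrite -natrM ler_nat mulnC ltnW// ltn_ceil.
Qed.

Theorem mainTheorem8 (R : realType) (d : nat) (p : R) (G : nat -> network) :
  (2 <= d)%N ->
  (d.+1%:R)^-1 < p -> p <= 1 ->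
  (#|G n| @[n --> \oo] --> \oo) ->
  (* every party of every large network, as the vertex set varies with n *)
  (forall v : (forall n, G n),
     2^-1 < limn_inf (fun n => (deg (v n))%:R / #|G n|%:R : R)) ->
  \forall n \near \oo, GME (@holder (G n)) (IPEN d p (G n)).
Proof.
move=> d2 dp p1 Goo degG.
(* Applying the degree hypothesis to a party of minimal degree in each network makes the lower bound
   uniform over all parties. *)
have mindeg n : exists v : G n, forall u : G n, (deg v <= deg u)%N.
  have /card_gt0P[v0 _] := party_nonempty (G n).
  case: (arg_minnP (@deg (G n)) (erefl : xpredT v0)) => v _ vP.
  by exists v => u; exact: (vP u isT).
pose v n := projT1 (cid (mindeg n)).
have vmin n (u : G n) : (deg (v n) <= deg u)%N := projT2 (cid (mindeg n)) u.
have deg01 n : 0 <= ((deg (v n))%:R / #|G n|%:R : R) <= 1.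
  rewrite divr_ge0// ler_pdivrMr ?ltr0n ?party_nonempty// mul1r ler_nat.
  exact: max_card.
have [e e0 ve] := limn_inf_gt deg01 (degG v).
have p0 : 0 <= p by apply: ltW; apply: le_lt_trans dp; rewrite invr_ge0.
pose r : R := (1 - p) * (1 + d%:R^-1).
have r0 : 0 <= r by rewrite mulr_ge0 ?subr_ge0 ?addr_ge0 ?invr_ge0.
have dR : 0 < d%:R :> R by rewrite ltr0n ltnW.
(* After multiplication by [d] this reads [(1 - p) (d + 1) < d], that is [p (d + 1) > 1]. *)
have r1 : r < 1.
  move: dp; rewrite -natr1 -div1r ltr_pdivrMr ?addr_gt0// => dp.
  rewrite -(ltr_pM2r dR) /r mul1r -mulrA [(1 + d%:R^-1) * _]mulrDl.
  rewrite mulVf ?gt_eqF// mul1r; nra.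
(* With [1/M < e], the integer [#|G n| %/ M] is at most [e #|G n|] and serves as [b] in
   [sum_cuts_le]. *)
pose M := (Num.truncn e^-1).+1.
have Me : M%:R^-1 < e.
  by rewrite invf_plt ?posrE ?ltr0n// truncnS_gt.
have [N0 HN0] := eventually_sum_cuts_lt1 r0 r1 (isT : 0 < M)%N.
have GN0 : \forall n \near \oo, (N0 <= #|G n|)%N.
  exact: (Goo _ (nbhs_infty_ge N0)).
near=> n.
have Nn : (N0 <= #|G n|)%N by near: n.
have en : 2^-1 + e <= (deg (v n))%:R / #|G n|%:R by near: n.
apply: GME_IPEN => //.
apply: le_lt_trans (HN0 _ Nn).
apply: (sum_cuts_le r0 (ltW r1) (vmin n)).
rewrite -(ler_nat R) natrD -!muln2 !natrM.
have G0 : 0 < #|G n|%:R :> R by rewrite ltr0n party_nonempty.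
have : (#|G n| %/ M)%:R <= #|G n|%:R * e.
  apply: le_trans (_ : #|G n|%:R * M%:R^-1 <= _); last by rewrite ler_pM2l// ltW.
  by rewrite ler_pdivlMr ?ltr0n// -natrM ler_nat leq_divM.
move: en; rewrite ler_pdivlMr//; lra.
Unshelve. all: by end_near.
Qed.
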